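(* Let $n\ge 4$, let $c=(c_1,\dots,c_m)$ be a cardinality sequence with $m\ge 2$, $2\le c_1<\dots<c_m\le n$ and $c\ne(2,3)$, and let $S\subset\tilde N_n$ with $0,n\in S$. The min-cut inequality $x((S:\tilde N_n\setminus S))\ge 1$ is valid for $P^{c}_{0,n\text{-path}}(\tilde D_n)$ if and only if $|S|\le c_1$, and it is facet defining for $P^{c}_{0,n\text{-path}}(\tilde D_n)$ if and only if $3\le |S|\le c_1$ and $|\tilde N_n\setminus S|\ge 2$.
   Context: $\tilde D_n=(\tilde N_n,\tilde A_n)$ is the digraph with $\tilde N_n=\{0,1,\dots,n\}$ and $\tilde A_n=\{(0,i),(i,n): i=1,\dots,n-1\}\cup\{(i,j):1\le i,j\le n-1, i\ne j\}$. $P^{c}_{0,n\text{-path}}(\tilde D_n)\subseteq\mathbb{R}^{\tilde A_n}$ is the convex hull of the incidence vectors of simple directed $(0,n)$-paths in $\tilde D_n$ whose number of arcs is in $\{c_1,\dots,c_m\}$. $(S:T)=\{(i,j)\in\tilde A_n:i\in S,j\in T\}$; $x(F)=\sum_{a\in F}x_a$. *)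

(* Defs.v *)
From HB Require Import structures.
From mathcomp Require Import all_boot all_order all_algebra.
From mathcomp Require Import classical_sets reals.

Set Implicit Arguments.
Unset Strict Implicit.
Unset Printing Implicit Defensive.

Import Order.TTheory GRing.Theory Num.Theory.

Local Open Scope ring_scope.

Section Polyhedra.
Variables (R : realType) (V : lmodType R).

Definition conv_hull (X : set V) : set V := fun x =>
  exists (k : nat) (p : 'I_k -> V) (a : 'I_k -> R),
    [/\ forall i, X (p i), forall i, 0 <= a i,
        \sum_i a i = 1 & x = \sum_i a i *: p i].

Definition aff_indep (k : nat) (p : 'I_k -> V) : Prop :=
  forall a : 'I_k -> R,
    \sum_i a i = 0 -> \sum_i a i *: p i = 0 -> forall i, a i = 0.

Definition has_aff_indep (X : set V) (k : nat) : Prop :=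
  exists p : 'I_k -> V, (forall i, X (p i)) /\ aff_indep p.

(* The dimension is the maximal number of affinely independent points minus
   one; it lives in int so that the empty set has dimension -1. *)
Definition has_dim (X : set V) (d : int) : Prop :=
  exists k : nat, [/\ d = k%:Z - 1, has_aff_indep X k &
    forall l, has_aff_indep X l -> (l <= k)%N].

Definition valid_ge (P : set V) (f : V -> R) (b : R) : Prop :=
  forall x, P x -> b <= f x.

Definition facet_defining_ge (P : set V) (f : V -> R) (b : R) : Prop :=
  valid_ge P f b /\
  exists d : int, has_dim P d /\ has_dim (fun x => P x /\ f x = b) (d - 1).

End Polyhedra.

Section Digraph.
Variable n : nat.

Definition node := 'I_n.+1.

Definition inner (i : node) : bool := (0 < i < n)%N.

Definition adj : rel node := fun i j =>
  [|| (i == ord0) && inner j, inner i && (j == ord_max)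
    | [&& inner i, inner j & i != j]].

Definition arc := {a : node * node | adj a.1 a.2}.

Definition cut (S T : {set node}) : {set arc} :=
  [set a : arc | ((val a).1 \in S) && ((val a).2 \in T)]%SET.

(* The path visits ord0 :: p in this order, so it has size p arcs. *)
Definition simple_path (p : seq node) : bool :=
  [&& path adj ord0 p, last ord0 p == ord_max & uniq (ord0 :: p)].

Definition path_arcs (p : seq node) : seq (node * node) := zip (ord0 :: p) p.

Variable R : realType.

Definition arc_space := {ffun arc -> R^o}.

Definition incidence (p : seq node) : arc_space :=
  [ffun a : arc => (val a \in path_arcs p)%:R].

Definition path_polytope (c : seq nat) : set arc_space :=
  conv_hull (fun x =>
    exists p, [/\ simple_path p, size p \in c & x = incidence p]).

Definition arc_sum (F : {set arc}) (x : arc_space) : R := \sum_(a in F) x a.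

End Digraph.

Arguments path_polytope : clear implicits.

(* Main.v *)
From Pilot Require Import Defs.
From HB Require Import structures.
From mathcomp Require Import all_boot all_order all_algebra.
From mathcomp Require Import classical_sets reals.
From mathcomp Require Import zify ring lra.

Set Implicit Arguments.
Unset Strict Implicit.
Unset Printing Implicit Defensive.

Import Order.TTheory GRing.Theory Num.Theory.

Local Open Scope ring_scope.

(* Write S' for the inner nodes of S and T for the complement of S. All path
   vectors lie on the hyperplane x(delta^+(0)) = 1, so dimensions are ranks of
   incidence vectors. Let b be arc weights summing to 0 on every path of
   cardinality c_1 or c_2 that enters T exactly once. Subtracting a node
   potential, one may assume that the arcs leaving 0 have weight 0. As
   |S| <= c_1, such a path can use all of S', or all but one node of it, and
   exchanging single nodes between two such paths determines b up to one
   parameter nu, namely b = nu on (T : S'), -nu on (S' : n), and 0 elsewhere;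
   the second cardinality rules out a constant weight per arc. Hence
   b(P) = nu (x(S : T) - 1) for every path P: the tight paths span a hyperplane
   in the span of all paths. *)

(** * Arc weights along node sequences, and the weights that vanish on tight paths *)

Section PathWeights.
Variables (V : finType) (R : realFieldType).
Implicit Types (b w : V -> V -> R) (u : V -> R) (x y : V) (p q : seq V).

Fixpoint weight b x p : R :=
  if p is y :: q then b x y + weight b y q else 0.

Lemma weight_cat b x p q :
  weight b x (p ++ q) = weight b x p + weight b (last x p) q.
Proof. by elim: p x => [|y p IH] x /=; rewrite ?add0r // IH addrA. Qed.

Lemma eq_weight_path (e : rel V) b w x p :
    (forall i j, e i j -> b i j = w i j) -> path e x p ->
  weight b x p = weight w x p.
Proof.
move=> bw; elim: p x => //= y p IH x /andP[exy ep].
by rewrite bw // IH.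
Qed.

(** Potential differences telescope. This serves twice: to normalise the arcs leaving 0, and to
    evaluate the weights found at the end. *)
Lemma weight_potential u (k : R) w x p :
  weight (fun i j => u i - u j + k * w i j) x p =
  u x - u (last x p) + k * weight w x p.
Proof. by elim: p x => /= [|y p ->] x; ring. Qed.

Lemma weight_zip b x p :
  weight b x p = \sum_(e <- zip (x :: p) p) b e.1 e.2.
Proof. by elim: p x => [|y p IH] x; rewrite ?big_nil // big_cons /= IH. Qed.

(** Supplies the filler nodes that bring a block of a path to a prescribed length. *)
Lemma exists_completion (A : {set V}) p r :
    uniq p -> {subset p <= A} -> (size p + r <= #|A|)%N ->
  exists q, [/\ uniq (p ++ q), {subset q <= A} & size q = r].
Proof.
move=> up sp hr; set f := [seq z <- enum A | z \notin p].
have uf : uniq f by rewrite filter_uniq ?enum_uniq.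
have sf : (r <= size f)%N.
  rewrite size_filter.
  have h := count_predC (mem p) (enum A).
  have -> : count (fun z => z \notin p) (enum A) = count (predC (mem p)) (enum A).
    by apply: eq_count.
  have : (count (mem p) (enum A) <= size p)%N.
    rewrite -size_filter; apply: uniq_leq_size.
      by rewrite filter_uniq ?enum_uniq.
    by move=> z; rewrite mem_filter => /andP[].
  move: (count _ _) (count _ _) h => u v h hu; rewrite cardE in hr.
  by move: hr; rewrite -h; lia.
exists (take r f); split.
- rewrite cat_uniq up take_uniq // andbT; apply/hasPn => z /mem_take.
  by rewrite mem_filter => /andP[].
- by move=> z /mem_take; rewrite mem_filter mem_enum => /andP[].
- by rewrite size_takel.
Qed.

Lemma uniq_cat_disjoint (A T : {set V}) p q :
    [disjoint A & T] -> uniq p -> uniq q -> {subset p <= A} ->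
  {subset q <= T} -> uniq (p ++ q).
Proof.
move=> dAT up uq pA qT; rewrite cat_uniq up uq andbT; apply/hasPn => z /qT zT.
by apply/negP => /pA zA; have := disjointFr dAT zA; rewrite zT.
Qed.

(** Here [A] plays the role of S', and [K], [K'] count the inner nodes of paths of the two
    cardinalities. A path [P ++ Q ++ C] visits [T] in the single block [Q]. The chain
    [#|A| < K < K' <= #|A| + #|T|] leaves at least two nodes in [T], as the exchanges require. *)
Lemma tight_functional (o d : V) (A T : {set V}) (K K' : nat) b :
    [disjoint A & T] -> (0 < #|A|)%N -> (#|A| < K)%N -> (K < K')%N ->
    (K' <= #|A| + #|T|)%N ->
    (forall i, (i \in A) || (i \in T) -> b o i = 0) ->
    (forall P Q C, uniq (P ++ C) -> uniq Q -> {subset P <= A} ->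
       {subset Q <= T} -> {subset C <= A} -> Q != [::] ->
       (size P + size Q + size C = K \/ size P + size Q + size C = K')%N ->
       weight b o (P ++ Q ++ C ++ [:: d]) = 0) ->
  exists nu, [/\ forall i j, (i \in A) || (i \in T) -> j \in T -> i != j ->
                   b i j = 0,
                 forall i j, i \in A -> j \in A -> i != j -> b i j = 0,
                 forall i j, i \in T -> j \in A -> b i j = nu,
                 forall i, i \in A -> b i d = - nu
               & forall i, i \in T -> b i d = 0].
Proof.
move=> dAT A0 AK KK' K'le b0 H.
have {}dAT z : z \in A -> z \in T -> False.
  by move=> zA; rewrite (disjointFr dAT zA).
(* Exchange the first node of the T-block for an unused node of A. *)
have E1 y j a P : y \in T -> j \in T -> j != y -> a \in A -> uniq (a :: P) ->
    {subset P <= A} ->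
    b (last o P) j + b j y = b (last o P) a + b a y.
  move=> yT jT jy aA uaP PA.
  have aPA : {subset a :: P <= A} by move=> z; rewrite inE => /predU1P[->|/PA].
  have szP := uniq_leq_size uaP (fun z hz => etrans (mem_enum _ z) (aPA z hz)).
  rewrite -cardE /= in szP.
  have [C [uC CA sC]] := @exists_completion A (a :: P) (#|A| - (size P).+1)
    uaP aPA ltac:(rewrite /=; lia).
  have jyT : {subset [:: j; y] <= T}.
    by move=> z; rewrite !inE => /orP[] /eqP ->.
  have ujy : uniq [:: j; y] by rewrite /= inE jy.
  (* The first path uses all of [A] except [a], the second all of [A]; this length of [Q] gives both
     exactly [K] inner nodes. *)
  have [Q [uQ QT sQ]] := @exists_completion T [:: j; y] (K - #|A|.+1)
    ujy jyT ltac:(rewrite /=; lia).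
  have h1 : weight b o (P ++ ([:: j; y] ++ Q) ++ C ++ [:: d]) = 0.
    apply: H => //.
    - by move: uC => /= /andP[].
    - by move=> z; rewrite mem_cat => /orP[/jyT|/QT].
    - by left; rewrite /= sQ sC; lia.
  have h2 : weight b o ((P ++ [:: a]) ++ (y :: Q) ++ C ++ [:: d]) = 0.
    apply: H => //.
    - by rewrite -catA uniq_catCA /= mem_cat negb_or; move: uC => /=; rewrite mem_cat negb_or.
    - by move: uQ => /= /andP[].
    - by move=> z; rewrite mem_cat inE => /orP[/PA|/eqP->].
    - by move=> z; rewrite inE => /predU1P[->|/QT].
    - by left; rewrite size_cat /= sQ sC; lia.
  move: h1 h2; rewrite -!catA !weight_cat /=; lra.
(* Exchange the last node of the T-block for an unused node of A. *)
have E2 x j a C : x \in T -> j \in T -> x != j -> a \in A -> uniq (a :: C) ->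
    {subset C <= A} ->
    b x j + b j (head d C) = b x a + b a (head d C).
  move=> xT jT xj aA uaP PA.
  have aPA : {subset a :: C <= A} by move=> z; rewrite inE => /predU1P[->|/PA].
  have szP := uniq_leq_size uaP (fun z hz => etrans (mem_enum _ z) (aPA z hz)).
  rewrite -cardE /= in szP.
  have [P [uP CA sC]] := @exists_completion A (a :: C) (#|A| - (size C).+1)
    uaP aPA ltac:(rewrite /=; lia).
  have jyT : {subset [:: x; j] <= T}.
    by move=> z; rewrite !inE => /orP[] /eqP ->.
  have ujy : uniq [:: x; j] by rewrite /= inE xj.
  have [Q [uQ QT sQ]] := @exists_completion T [:: x; j] (K - #|A|.+1)
    ujy jyT ltac:(rewrite /=; lia).
  have h1 : weight b o (P ++ (Q ++ [:: x; j]) ++ C ++ [:: d]) = 0.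
    apply: H => //.
    - by rewrite uniq_catC; move: uP => /= /andP[].
    - by rewrite uniq_catC.
    - by move=> z; rewrite mem_cat => /orP[/QT|/jyT].
    - by case: (Q).
    - by left; rewrite /= size_cat /= sQ sC; lia.
  have h2 : weight b o (P ++ (Q ++ [:: x]) ++ (a :: C) ++ [:: d]) = 0.
    apply: H => //.
    - by rewrite uniq_catC.
    - by move: uQ; rewrite uniq_catC -(cat1s x) catA cat_uniq => /andP[].
    - by move=> z; rewrite mem_cat inE => /orP[/QT|/eqP->].
    - by case: (Q).
    - by left; rewrite size_cat /= sQ sC; lia.
  move: h1 h2; rewrite -!catA !weight_cat /= -/cat.
  (* The node after the exchanged one is the first of [C], or the sink [d] when [C] is empty; hence
     [head d C]. *)
  by case: (C) => [|c0 C'] /=; lra.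
have [a0 a0A] : exists a0, a0 \in A by apply/card_gt0P.
have sbE : {subset enum A <= A} by move=> z; rewrite mem_enum.
have szE : size (enum A) = #|A| by rewrite -cardE.
have other y : y \in T -> exists2 j, j \in T & j != y.
  move=> yT; have : (0 < #|T :\ y|)%N by have := cardsD1 y T; rewrite yT; lia.
  by case/card_gt0P => j; rewrite !inE => /andP[? ?]; exists j.
pose w y := b a0 y.
(* The weight of an arc into [y] in [T] does not depend on its tail: in [E1] with empty [P] the arcs
   leaving [o] contribute 0. *)
have bw i y : (i \in A) || (i \in T) -> y \in T -> i != y -> b i y = w y.
  move=> iAT yT iy.
  have hT j a : j \in T -> j != y -> a \in A -> b j y = b a y.
    move=> jT jy aA; have := @E1 y j a [::] yT jT jy aA isT ltac:(by []).
    by rewrite /= !b0 ?aA ?jT ?orbT // !add0r.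
  case/orP: iAT => [iA|iT]; last exact: hT.
  have [j jT jy] := other y yT.
  by rewrite -(hT j i) ?(hT j a0).
have bwl Q x : uniq Q -> {subset Q <= T} -> x \in T -> x \notin Q ->
    b (last o (enum A ++ Q)) x = w x.
  (* As [A] is nonempty, the last node is not the source [o], whose arcs have weight 0 rather than
     [w x]. *)
  move=> uQ QT xT xQ.
  have : last o (enum A ++ Q) \in enum A ++ Q.
    case: (enum A) szE => [h|z p _]; last exact: (mem_last z (p ++ Q)).
    by rewrite -h in A0.
  rewrite mem_cat mem_enum => zAQ; apply: bw => //.
    by case/orP: zAQ => [->//|/QT->]; rewrite orbT.
  apply: contraTneq zAQ => ->; rewrite negb_or xQ andbT.
  by apply/negP => /dAT; apply.
have HA Q : uniq Q -> {subset Q <= T} -> Q != [::] ->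
    (#|A| + size Q = K \/ #|A| + size Q = K')%N ->
    weight b o (enum A ++ Q) + b (last o (enum A ++ Q)) d = 0.
  move=> uQ QT Q0 sQ; have := H (enum A) Q [::].
  rewrite cats0 enum_uniq /= addn0 szE catA weight_cat /= addr0.
  by apply.
(* Compare two paths through all of [A], then [Q], that differ only in their last inner node. *)
have E3 j k : j \in T -> k \in T -> w j + b j d = w k + b k d.
  move=> jT kT; have [->//|jk] := eqVneq j k.
  have ujk : uniq [:: j; k] by rewrite /= inE jk.
  have jkT : {subset [:: j; k] <= T} by move=> z; rewrite !inE => /orP[] /eqP ->.
  have [Q [uQ QT sQ]] := @exists_completion T [:: j; k] (K - #|A|.+1)
    ujk jkT ltac:(rewrite /=; lia).
  move: uQ; rewrite cat_uniq /= !negb_or => /and3P[_ /hasPn jkQ uQ].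
  have h x : x \in [:: j; k] -> w x + b x d = - weight b o (enum A ++ Q).
    move=> xjk; have xQ : x \notin Q by apply/negP => /jkQ; rewrite /= xjk.
    set Q' := rcons Q x.
    have : weight b o (enum A ++ Q') + b (last o (enum A ++ Q')) d = 0.
      apply: HA.
      - by rewrite rcons_uniq xQ.
      - by move=> z; rewrite mem_rcons inE => /predU1P[->|/QT //]; apply: jkT.
      - by rewrite /Q'; case: (Q).
      - by left; rewrite size_rcons sQ; lia.
    rewrite /Q' -cats1 catA cats1 last_rcons -cats1 weight_cat /= bwl ?jkT //.
    by lra.
  by rewrite !h // !inE eqxx ?orbT.
(* Swap the last two nodes of a path of the larger cardinality. *)
have E4 j k : j \in T -> k \in T -> b j d = b k d.
  move=> jT kT; have [->//|jk] := eqVneq j k.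
  have ujk : uniq [:: j; k] by rewrite /= inE jk.
  have jkT : {subset [:: j; k] <= T} by move=> z; rewrite !inE => /orP[] /eqP ->.
  have [Q [uQ QT sQ]] := @exists_completion T [:: j; k] (K' - #|A|.+2)
    ujk jkT ltac:(rewrite /=; lia).
  move: uQ; rewrite cat_uniq /= => /and3P[_ /hasPn jkQ uQ].
  have h x y : x \in [:: j; k] -> y \in [:: j; k] -> x != y ->
      w x + w y + b y d = - weight b o (enum A ++ Q).
    move=> xjk yjk xy.
    have xQ : x \notin Q by apply/negP => /jkQ; rewrite /= xjk.
    have yQ : y \notin Q by apply/negP => /jkQ; rewrite /= yjk.
    set Q' := Q ++ [:: x; y].
    have : weight b o (enum A ++ Q') + b (last o (enum A ++ Q')) d = 0.
      apply: HA.
      - by rewrite uniq_catC /= !inE negb_or xy xQ yQ.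
      - by move=> z; rewrite mem_cat !inE => /or3P[/QT //|/eqP->|/eqP->]; apply: jkT.
      - by rewrite /Q'; case: (Q).
      - by right; rewrite size_cat sQ /=; lia.
    rewrite /Q' catA weight_cat (last_cat _ (enum A ++ Q)) /= bwl ?jkT // (bw x y) ?jkT ?orbT //.
    by lra.
  have := h j k; have := h k j; rewrite !inE !eqxx ?orbT (eq_sym k) jk.
  by move=> /(_ isT isT isT) h1 /(_ isT isT isT) h2; lra.
have [t0 t0T] : exists t0, t0 \in T by apply/card_gt0P; lia.
(* [E3] makes [w j + b j d] constant on [T] and [E4] makes [b j d] constant, so [w] is constant. *)
have wT j : j \in T -> w j = w t0.
  by move=> jT; have := E3 j t0 jT t0T; rewrite (E4 j t0) //; apply: addIr.
have WQ Q : uniq Q -> {subset Q <= T} ->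
    weight b o (enum A ++ Q) = weight b o (enum A) + w t0 *+ size Q.
  elim/last_ind: Q => [|Q x IH]; first by rewrite cats0 addr0.
  rewrite rcons_uniq size_rcons mulrSr => /andP[xQ uQ] QT.
  have xT : x \in T by apply: QT; rewrite mem_rcons mem_head.
  have {}QT : {subset Q <= T} by move=> z zQ; apply: QT; rewrite mem_rcons inE zQ orbT.
  by rewrite -cats1 catA weight_cat IH //= bwl // wT // !addrA addr0.
have HT k : k = K \/ k = K' ->
    weight b o (enum A) + w t0 *+ (k - #|A|) + b t0 d = 0.
  move=> hk; have [Q [uQ QT sQ]] := @exists_completion T [::] (k - #|A|)
    isT ltac:(by []) ltac:(rewrite /=; lia).
  have := HA Q uQ QT; rewrite WQ // sQ.
  case: (lastP Q) sQ QT => [|Q' x] sQ QT; first by move: sQ => /=; lia.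
  have xT : x \in T by apply: QT; rewrite mem_rcons mem_head.
  rewrite last_cat last_rcons (E4 x t0) //; apply; first by case: (Q').
  by case: hk; lia.
(* Subtracting the equations [HT] for [K] and [K'] leaves [(K' - K)] times [w t0]. *)
have w0 : w t0 = 0.
  have h1 := HT K (or_introl erefl); have h2 := HT K' (or_intror erefl).
  have : w t0 *+ (K' - K) = 0.
    have -> : (K' - K = (K' - #|A|) - (K - #|A|))%N by lia.
    by rewrite mulrnBr; [rewrite -(addrK (b t0 d) (_ *+ _)); lra|lia].
  by move/eqP; rewrite mulrn_eq0 => /orP[|/eqP//]; lia.
(* In [E1] with [P] reduced to [x], every arc into [T] now has weight 0, and only [b x a]
   remains. *)
have AA x a : x \in A -> a \in A -> x != a -> b x a = 0.
  move=> xA aA xa; have [j jT jt0] := other t0 t0T.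
  have := @E1 t0 j a [:: x] t0T jT jt0 aA.
  rewrite /= inE eq_sym xa => /(_ isT).
  have h : {subset [:: x] <= A} by move=> z; rewrite inE => /eqP ->.
  have neT z v : z \in A -> v \in T -> z != v.
    by move=> zA vT; apply/eqP => zv; apply: (dAT z); rewrite // zv.
  have xj := neT x j xA jT; have at0 := neT a t0 aA t0T.
  move=> /(_ h); rewrite (bw x j) ?(bw j t0) ?(bw a t0) ?xA ?aA ?jT ?orbT //.
  by rewrite (wT j) // w0 !addr0 => <-.
have WA : weight b o (enum A) = 0.
  case: (enum A) (enum_uniq A) sbE => [//|z p] /= + sub.
  rewrite b0 ?sub ?mem_head // add0r.
  elim: p z sub => [//|y p IH] z sub /= /and3P[zp yp up].
  rewrite AA ?sub ?mem_head ?inE ?eqxx ?orbT //; last first.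
    by apply: contraNneq zp => ->; rewrite mem_head.
  rewrite add0r IH //= ?yp // => v vp; apply: sub; by rewrite inE vp orbT.
have Td i : i \in T -> b i d = 0.
  move=> iT; rewrite (E4 i t0) //; have := HT K (or_introl erefl).
  by rewrite WA w0 mul0rn !add0r.
have bT i j : (i \in A) || (i \in T) -> j \in T -> i != j -> b i j = 0.
  by move=> h1 h2 h3; rewrite bw // wT.
(* [E2] with empty [C]: the arcs [(i, j)] and [(j, d)] have weight 0. *)
have TA i a : i \in T -> a \in A -> b i a = - b a d.
  move=> iT aA; have [j jT ji] := other i iT.
  have := @E2 i j a [::] iT jT ltac:(by rewrite eq_sym) aA isT ltac:(by []).
  by rewrite /= Td // bT ?iT ?orbT // 1?eq_sym //; lra.
(* [E2] with [C] reduced to [a0] equates the weights of [(j, a0)] and [(t0, a)], which [TA] turns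
   into weights of arcs to [d]. *)
have Ad a : a \in A -> b a d = b a0 d.
  move=> aA; have [->//|aa0] := eqVneq a a0.
  have [j jT jt0] := other t0 t0T.
  have := @E2 t0 j a [:: a0] t0T jT ltac:(by rewrite eq_sym) aA.
  rewrite /= inE aa0 => /(_ isT).
  have h : {subset [:: a0] <= A} by move=> z; rewrite inE => /eqP ->.
  have t0j : t0 != j by rewrite eq_sym.
  move=> /(_ h); rewrite (bT t0 j) ?t0T ?orbT // (AA a a0) //.
  by rewrite (TA j a0) // (TA t0 a) //; lra.
exists (- b a0 d); split=> //.
- by move=> i j iT jA; rewrite TA // Ad.
- by move=> i iA; rewrite opprK Ad.
Qed.

(** * Counting how often a path leaves S *)

Definition cut_weight (S : {set V}) : V -> seq V -> R :=
  weight (fun i j => ((i \in S) && (j \notin S))%:R).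

Variable S : {set V}.

Lemma cut_weight_ge0 x p : 0 <= cut_weight S x p.
Proof.
by rewrite /cut_weight; elim: p x => //= y p IH x; rewrite addr_ge0 ?ler0n.
Qed.

Lemma cut_weight_cat x p q :
  cut_weight S x (p ++ q) = cut_weight S x p + cut_weight S (last x p) q.
Proof. exact: weight_cat. Qed.

Lemma cut_weight_head x p : {subset p <= S} -> cut_weight S x p = 0.
Proof.
rewrite /cut_weight; elim: p x => //= y p IH x pS; rewrite (pS y) ?mem_head //= andbF add0r.
by apply: IH => z zp; apply: pS; rewrite inE zp orbT.
Qed.

Lemma cut_weight_tail x p : {subset x :: p <= ~: S} -> cut_weight S x p = 0.
Proof.
rewrite /cut_weight; elim: p x => //= y p IH x pS.
have := pS x (mem_head _ _); rewrite inE => /negPf -> /=; rewrite add0r.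
by apply: IH => z zp; apply: pS; rewrite inE zp orbT.
Qed.

Lemma cut_weight_ge1 x p y : x \in S -> y \in p -> y \notin S ->
  1 <= cut_weight S x p.
Proof.
move=> + + yS; rewrite /cut_weight; elim: p x => //= z p IH x xS.
rewrite inE xS /=; have [zS|zS] := boolP (z \in S) => /=.
  case/predU1P=> [yz|yp]; first by rewrite yz zS in yS.
  by rewrite add0r IH.
by move=> _; rewrite ler_wpDr // cut_weight_ge0.
Qed.

(** The only arc from [S] to its complement is the one entering the first node of [Q]. *)
Lemma cut_weight_block x (P Q C : seq V) : x \in S -> {subset P <= S} ->
    {subset Q <= ~: S} -> {subset C <= S} -> Q != [::] ->
  cut_weight S x (P ++ Q ++ C) = 1.
Proof.
move=> xS PS QS CS; case: Q QS => // y Q QS _.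
rewrite cut_weight_cat cut_weight_head // add0r /=.
have lS : last x P \in S.
  by have := mem_last x P; rewrite inE => /predU1P[->|/PS].
have yS : y \notin S by have := QS y (mem_head _ _); rewrite inE.
have -> : cut_weight S (last x P) (y :: Q ++ C) = 1 + cut_weight S y (Q ++ C).
  by rewrite /cut_weight /= lS yS.
by rewrite cut_weight_cat cut_weight_tail // cut_weight_head // !addr0.
Qed.

End PathWeights.

(** * Dimensions of convex hulls as ranks, and a criterion for facets *)

Section Dimension.
Variables (R : realType) (V : vectType R).
Implicit Types (L s : seq V) (X Y : set V).

(** The affinely independent points must belong to the given set, so the basis of the span is picked
    from [L] itself. *)
Lemma exists_free_subset L :
  exists s, [/\ {subset s <= L}, free s & <<s>>%VS = <<L>>%VS].
Proof.
elim: L => [|v L [s [sL fs es]]]; first by exists [::]; rewrite nil_free.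
have [vs|vs] := boolP (v \in <<s>>%VS).
  exists s; split=> //; first by move=> x /sL; rewrite inE orbC => ->.
  by rewrite span_cons -es; apply/esym/addv_idPr; rewrite -memvE.
exists (v :: s); split; last by rewrite !span_cons es.
  by move=> x; rewrite !inE => /predU1P[->|/sL ->]; rewrite ?eqxx ?orbT.
by rewrite free_cons vs.
Qed.

Lemma has_dim_unique X d d' : has_dim X d -> has_dim X d' -> d = d'.
Proof.
move=> [k [-> hk mk]] [l [-> hl ml]].
by have -> : k = l by apply/eqP; rewrite eqn_leq mk // ml.
Qed.

(* On a hyperplane missing the origin, affine independence is linear
   independence. *)
Lemma has_dim_span Y L (h : {scalar V}) :
    (forall x, x \in L -> Y x) -> (forall x, Y x -> x \in <<L>>%VS) ->
    (forall x, Y x -> h x = 1) ->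
  has_dim Y ((\dim <<L>>%VS)%:Z - 1).
Proof.
move=> LY YL h1; exists (\dim <<L>>%VS); split=> //.
  have [s [sL fs <-]] := exists_free_subset L.
  rewrite (eqP fs); exists (fun i : 'I_(size s) => s`_i); split.
    by move=> i; apply/LY/sL/mem_nth.
  by move=> a _; apply: (elimT (@freeP _ _ _ (in_tuple s)) fs).
move=> l [p [pY pI]].
have : free [tuple p i | i < l].
  apply/freeP => a; under eq_bigr do rewrite -tnth_nth tnth_mktuple.
  (* Since [h] is 1 at every point, applying it to a linear relation shows that the coefficients sum
     to 0. *)
  move=> a0; apply: pI => //; have := congr1 h a0.
  rewrite linear_sum linear0 => h0; rewrite -[RHS]h0; apply: eq_bigr => i _.
  by rewrite linearZ /= h1 ?mulr1.
move/eqP; rewrite size_tuple => <-; apply/dimvS/span_subvP => x /mapP[i _ ->].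
exact: YL.
Qed.

Variables (X : set V) (L : seq V) (f h : {scalar V}).
Hypothesis XL : forall x, X x <-> x \in L.
Hypothesis h1 : forall x, X x -> h x = 1.

Lemma conv_hull_sub x : X x -> conv_hull X x.
Proof.
move=> Xx; exists 1%N, (fun=> x), (fun=> 1); split=> //.
- by rewrite big_ord1.
- by rewrite big_ord1 scale1r.
Qed.

Lemma conv_hull_span x : conv_hull X x -> x \in <<L>>%VS.
Proof.
move=> [k [p [a [Xp _ _ ->]]]]; apply: memv_suml => i _.
by apply/memvZ/memv_span/XL.
Qed.

Lemma conv_hull_scalar x : conv_hull X x -> h x = 1.
Proof.
move=> [k [p [a [Xp _ <- ->]]]]; rewrite linear_sum; apply: eq_bigr => i _.
by rewrite linearZ /= h1 ?mulr1.
Qed.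

Lemma conv_hull_valid : (forall x, X x -> 1 <= f x) -> valid_ge (conv_hull X) f 1.
Proof.
move=> f1 x [k [p [a [Xp a0 <- ->]]]]; rewrite linear_sum.
by apply: ler_sum => i _; rewrite linearZ /= ler_peMr // f1.
Qed.

(** The nonnegative terms [a i * (f (p i) - 1)] sum to 0, so every generator with a nonzero
    coefficient is tight. *)
Lemma conv_hull_face x : (forall x, X x -> 1 <= f x) -> conv_hull X x ->
  f x = 1 -> x \in <<[seq y <- L | f y == 1]>>%VS.
Proof.
move=> f1 [k [p [a [Xp a0 a1 ->]]]] fx.
have : \sum_i a i * (f (p i) - 1) = 0.
  transitivity (f (\sum_i a i *: p i) - \sum_i a i); last by rewrite fx a1 subrr.
  rewrite linear_sum -sumrB; apply: eq_bigr => i _.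
  by rewrite linearZ /= mulrBr mulr1.
move=> /eqP; rewrite psumr_eq0 => [/allP z|i _]; last first.
  by rewrite mulr_ge0 ?subr_ge0 ?f1.
apply: memv_suml => i _; have := z i (mem_index_enum _).
rewrite /= mulf_eq0 => /orP[/eqP->|]; first by rewrite scale0r mem0v.
rewrite subr_eq0 => fi; apply/memvZ/memv_span; rewrite mem_filter fi /=.
exact/XL.
Qed.

(** The tight generators together with the single non-tight [v] span everything, so passing to the
    face lowers the rank by exactly one. *)
Lemma facet_criterion v :
    (forall x, X x -> 1 <= f x) -> v \in L -> f v != 1 ->
    (forall x, x \in L -> x \in (<<[seq y <- L | f y == 1%R]>> + <[v]>)%VS) ->
  facet_defining_ge (conv_hull X) f 1.
Proof.
set LF := [seq y <- L | _] => f1 vL fv sub; split; first exact: conv_hull_valid.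
exists ((\dim <<L>>%VS)%:Z - 1); split.
  apply: (@has_dim_span _ _ h) => x; first by move/XL/conv_hull_sub.
    exact: conv_hull_span.
  exact: conv_hull_scalar.
suff -> : (\dim <<L>>%VS)%:Z - 1 - 1 = (\dim <<LF>>%VS)%:Z - 1.
  apply: (@has_dim_span _ _ h) => x.
  - by rewrite mem_filter => /andP[/eqP ? /XL/conv_hull_sub].
  - by case; apply: conv_hull_face.
  - by case=> /conv_hull_scalar.
have -> : <<L>>%VS = (<<LF>> + <[v]>)%VS.
  apply/eqP; rewrite eqEsubv; apply/andP; split; first exact/span_subvP.
  rewrite subv_add -memvE memv_span // andbT; apply: sub_span => x.
  by rewrite mem_filter => /andP[].
(* [f] and [h] agree on the tight generators, hence on their span, but [h v = 1] while [f v] is not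
   1. *)
have vLF : v \notin <<LF>>%VS.
  apply: contraNN fv => vLF; apply/eqP.
  have [k vE] : exists k : 'I_(size LF) -> R, v = \sum_i k i *: LF`_i.
    by exists ((coord (in_tuple LF))^~ v); apply: (@coord_span _ _ _ (in_tuple LF)).
  rewrite -(h1 (proj2 (XL v) vL)) vE !linear_sum; apply: eq_bigr => i _.
  rewrite !linearZ /=; congr (_ * _).
  have : LF`_i \in LF by rewrite mem_nth.
  by rewrite mem_filter => /andP[/eqP-> /XL/h1].
have v0 : v != 0 by apply: contraNneq vLF => ->; rewrite mem0v.
rewrite dimv_disjoint_sum; last first.
  apply/eqP; rewrite -subv0; apply/subvP => x; rewrite memv_cap => /andP[xL].
  move/vlineP => [k xk]; move: xL; rewrite xk memv0.
  have [->|k0] := eqVneq k 0; first by rewrite scale0r.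
  by rewrite rpredZeq (negPf k0) (negPf vLF).
by rewrite dim_vline v0; lia.
Qed.

End Dimension.

(** The residual [u - projV U u] vanishes on [U] and has a nonzero coordinate [i0] at [v]. That
    coordinate is a linear functional, and [b] lists its values on the unit vectors. *)
Lemma exists_separating_weights (R : fieldType) (I : finType)
    (U : {vspace {ffun I -> R^o}}) (v : {ffun I -> R^o}) : v \notin U ->
  exists b : I -> R, (forall u, u \in U -> \sum_i b i * u i = 0) /\
                     \sum_i b i * v i != 0.
Proof.
move=> vU; pose g u := u - projv U u.
have [i0 gi0] : exists i, g v i != 0.
  apply/existsP; apply: contraNT vU; rewrite negb_exists => /forallP g0.
  suff /subr0_eq -> : g v = 0 by exact: memv_proj.
  by apply/ffunP => i; rewrite [RHS]ffunE; apply/eqP; rewrite -[_ == _]negbK g0.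
pose dl i : {ffun I -> R^o} := [ffun j => (j == i)%:R].
have gE (u : {ffun I -> R^o}) : \sum_i g (dl i) i0 * u i = g u i0.
  have uE : u = \sum_i u i *: dl i.
    apply/ffunP => j; rewrite sum_ffunE (bigD1 j) //= big1 => [|i ij].
      by rewrite !ffunE eqxx addr0; exact/esym/mulr1.
    by rewrite !ffunE eq_sym (negPf ij) scaler0.
  rewrite [in RHS]uE /g linear_sum /= -sumrB sum_ffunE; apply: eq_bigr => i _.
  by rewrite linearZ /= -scalerBr !ffunE mulrC.
exists (fun i => g (dl i) i0); split=> [u uU|]; last by rewrite gE.
by rewrite gE /g projv_id // subrr ffunE.
Qed.

(** * Simple (0,n)-paths and their incidence vectors *)

Section Digraph.
Variables (n : nat) (R : realType).
Implicit Types (S T : {set node n}) (p : seq (node n)).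

Lemma arc_sum_linear (F : {set Defs.arc n}) :
  linear_for *%R (@arc_sum n R F : arc_space n R -> R).
Proof.
move=> k x y; rewrite /arc_sum mulr_sumr -big_split; apply: eq_bigr => a _.
by rewrite !ffunE.
Qed.

HB.instance Definition _ (F : {set Defs.arc n}) :=
  @GRing.isLinear.Build R (arc_space n R) R *%R (@arc_sum n R F)
    (@arc_sum_linear F).

Lemma path_zip (I : Type) (e : rel I) x (p : seq I) :
  path e x p = all (fun a => e a.1 a.2) (zip (x :: p) p).
Proof. by elim: p x => //= y p IH x; rewrite IH. Qed.

Lemma sum_incidence (b : node n -> node n -> R) p : simple_path p ->
  \sum_a b (val a).1 (val a).2 * incidence R p a = weight b ord0 p.
Proof.
case/and3P => padj _ /= /andP[_ up]; rewrite weight_zip -/(path_arcs p).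
(* The heads of the arcs are the distinct nodes of [p], so no arc is counted twice. *)
have ua : uniq (path_arcs p).
  apply: (@map_uniq _ _ snd); rewrite -/(unzip2 _) unzip2_zip //=.
have aa : all (fun a => adj a.1 a.2) (path_arcs p) by rewrite -path_zip.
rewrite [RHS]big_uniq //=.
pose G (e : node n * node n) := if e \in path_arcs p then b e.1 e.2 else 0.
transitivity (\sum_(a : Defs.arc n) G (val a)).
  apply: eq_bigr => a _; rewrite ffunE /G; case: ifP => _; first by rewrite mulr1.
  by rewrite mulr0.
transitivity (\sum_(e : node n * node n | adj e.1 e.2) G e).
  exact/esym/(@big_sub _ _ _ _ (fun e => adj e.1 e.2) G).
rewrite /G -big_mkcondr; apply: eq_bigl => e /=.
by case: (boolP (e \in _)) => [/(allP aa) ->|]; rewrite ?andbF.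
Qed.

Lemma arc_sum_incidence S T p : simple_path p ->
  arc_sum (cut S T) (incidence R p) =
  weight (fun i j => ((i \in S) && (j \in T))%:R) ord0 p.
Proof.
move=> sp; rewrite -sum_incidence // /arc_sum big_mkcond; apply: eq_bigr => a _.
by rewrite !inE; case: ifP => _; rewrite ?mul1r ?mul0r.
Qed.

Lemma arc_sum_cut S p : simple_path p ->
  arc_sum (cut S (~: S)) (incidence R p) = cut_weight R S ord0 p.
Proof.
move=> sp; rewrite arc_sum_incidence //; case/and3P: sp => pp _ _.
by apply: eq_weight_path pp => i j _; rewrite inE.
Qed.

Lemma innerE (i : node n) : inner i = (i != ord0) && (i != ord_max).
Proof.
rewrite /inner -!val_eqE /= lt0n; congr (_ && _).
by rewrite ltn_neqAle -ltnS ltn_ord andbT.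
Qed.

Lemma adj_ord0 (j : node n) : adj ord0 j = inner j.
Proof. by rewrite /adj eqxx /= orbC; case: (inner j) => //=. Qed.

(** A simple path leaves 0 and never returns. This is the hyperplane missing the origin on which all
    path vectors lie. *)
Lemma arc_sum_source p : (0 < n)%N -> simple_path p ->
  arc_sum (cut [set ord0] [set: node n]) (incidence R p) = 1.
Proof.
move=> n0 sp; rewrite arc_sum_incidence //; case/and3P: sp => _.
case: p => [/eqP/(congr1 val)/= n00|y p _ /= /andP[o _]]; first by rewrite -n00 in n0.
rewrite !inE eqxx /= -[RHS]addr0; congr (_ + _).
elim: p y o => //= z p IH y; rewrite !inE negb_or => /andP[oy op].
by rewrite eq_sym (negPf oy) add0r IH.
Qed.

(** Distinct inner nodes are joined in both directions, so they may be visited in any order. *)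
Lemma simple_path_inner p : uniq p -> all (@inner n) p -> p != [::] ->
  simple_path (p ++ [:: ord_max]).
Proof.
case: p => // y p uy /= /andP[iy ip] _.
have inn0 (z : node n) : inner z -> z != ord0 by rewrite innerE => /andP[].
have innn (z : node n) : inner z -> z != ord_max by rewrite innerE => /andP[].
have n0 : ord0 != ord_max :> node n.
  by rewrite -val_eqE /= eq_sym; move: iy; rewrite /inner; lia.
apply/and3P; split.
- rewrite /= adj_ord0 iy /=.
  elim: p y uy iy ip => [|z p IH] y /=.
    by rewrite /adj => _ -> _; rewrite eqxx /= orbT.
  rewrite inE negb_or => /and3P[/andP[yz _] zp up] iy /andP[iz ip].
  by rewrite IH //= ?zp // andbT /adj iy iz yz /= !orbT.
- by rewrite /= last_cat.
- rewrite -cat_cons -cat_cons uniq_catC /= !inE !negb_or eq_sym n0.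
  move: uy => /= -> /=; rewrite andbT -!andbA; apply/and4P; split.
  + by rewrite eq_sym innn.
  + by apply/negP => /(allP ip)/innn; rewrite eqxx.
  + by rewrite eq_sym inn0.
  + by apply/negP => /(allP ip)/inn0; rewrite eqxx.
Qed.

(** A finite list of the generators of the polytope, so that spans can be formed; paths with [k]
    arcs are enumerated as [k]-tuples. *)
Definition incidences (c : seq nat) : seq (arc_space n R) :=
  flatten [seq [seq incidence R (tval t) | t <- enum {: k.-tuple (node n)}
                                         & simple_path (tval t)] | k <- c].

Lemma incidencesP c x :
  (exists p, [/\ simple_path p, size p \in c & x = incidence R p])
  <-> x \in incidences c.
Proof.
split=> [[p [sp pc ->]]|/flatten_mapP[k kc /mapP[t]]].
  apply/flatten_mapP; exists (size p) => //; apply/mapP.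
  by exists (in_tuple p) => //; rewrite mem_filter sp mem_enum.
rewrite mem_filter => /andP[sp _] ->; exists t; split=> //.
by rewrite size_tuple.
Qed.

End Digraph.

(** * Paths relative to a node set S that contains both terminals *)

Section Cut.
Variables (n : nat) (R : realType) (S : {set node n}).
Hypotheses (S0 : ord0 \in S) (Sn : ord_max \in S).
Implicit Types (p : seq (node n)).

Definition inner_part : {set node n} := S :\ ord0 :\ ord_max.

Lemma inner_partP i : i \in inner_part = (i \in S) && inner i.
Proof. by rewrite !inE innerE; case: (i \in S); rewrite ?andbF // !andbT andbC. Qed.

Lemma notin_inner i : i \notin S -> inner i.
Proof.
by move=> iS; rewrite innerE; apply/andP; split;
  apply: contraNneq iS => ->.
Qed.

Lemma disjoint_inner_part : [disjoint inner_part & ~: S].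
Proof.
rewrite disjoint_subset; apply/fintype.subsetP => i.
by rewrite inner_partP !inE negbK => /andP[].
Qed.

Lemma card_inner_part : (0 < n)%N -> #|S| = (#|inner_part| + 2)%N.
Proof.
move=> n0; rewrite (cardsD1 ord0) S0 (cardsD1 ord_max) !inE Sn andbT.
by rewrite -val_eqE /= -lt0n n0 addnA addnC.
Qed.

Lemma simple_path_cat (P Q C : seq (node n)) :
    uniq (P ++ C) -> uniq Q -> {subset P <= inner_part} ->
    {subset Q <= ~: S} -> {subset C <= inner_part} -> Q != [::] ->
  simple_path (P ++ Q ++ C ++ [:: ord_max]).
Proof.
move=> uPC uQ PA QT CA Q0; rewrite catA (catA (P ++ Q)); apply: simple_path_inner.
- rewrite -catA uniq_catCA.
  apply: (@uniq_cat_disjoint _ (~: S) inner_part) => //; last first.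
    by move=> z; rewrite mem_cat => /orP[/PA|/CA].
  by rewrite disjoint_sym disjoint_inner_part.
- apply/allP => z; rewrite !mem_cat => /orP[/orP[/PA|/QT]|/CA].
  + by rewrite inner_partP => /andP[].
  + by rewrite inE => /notin_inner.
  + by rewrite inner_partP => /andP[].
- by move: Q0; rewrite -!size_eq0 !size_cat; lia.
Qed.

(** Weights vanishing on the tight paths of two cardinalities are determined, on all simple paths,
    up to one scalar. *)
Lemma weight_of_tight (b : node n -> node n -> R) k k' :
    (2 < #|S| <= k)%N -> (k < k' <= n)%N ->
    (forall p, simple_path p -> size p \in [:: k; k'] ->
       cut_weight R S ord0 p = 1 -> weight b ord0 p = 0) ->
  exists nu, forall p, simple_path p ->
    weight b ord0 p = nu * (cut_weight R S ord0 p - 1).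
Proof.
move=> /andP[S3 Sk] /andP[kk' k'n] H.
have n0 : (0 < n)%N by lia.
have cA := card_inner_part n0.
have cS : (#|S| + #|~: S| = n.+1)%N by rewrite cardsC card_ord.
have h1 : (0 < #|inner_part|)%N by lia.
have h2 : (#|inner_part| < k.-1)%N by lia.
have h3 : (k.-1 < k'.-1)%N by lia.
have h4 : (k'.-1 <= #|inner_part| + #|~: S|)%N by lia.
(* This potential cancels the arcs leaving 0; being 0 at both terminals, it preserves the weight of
   every (0,n)-path. *)
pose g i := if inner i then b ord0 i else 0.
have g0 : g ord0 = 0 by rewrite /g innerE eqxx.
have gn : g ord_max = 0 by rewrite /g innerE eqxx andbF.
pose b' i j := g i - g j + 1 * b i j.
have wb' p : simple_path p -> weight b' ord0 p = weight b ord0 p.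
  by case/and3P=> _ /eqP l _; rewrite weight_potential l g0 gn subrr add0r mul1r.
have inA i : i \in inner_part -> inner i by rewrite inner_partP => /andP[].
have inT i : i \in ~: S -> inner i by rewrite inE; apply: notin_inner.
(* A path with [k] arcs has [k.-1] inner nodes. *)
have := @tight_functional _ _ ord0 ord_max inner_part (~: S) k.-1 k'.-1 b'.
case.
- exact: disjoint_inner_part.
- exact: h1.
- exact: h2.
- exact: h3.
- exact: h4.
- move=> i h; have ii : inner i by case/orP: h => [/inA|/inT].
  by rewrite /b' g0 /g ii mul1r sub0r addNr.
- move=> P Q C uPC uQ PA QT CA Q0 sz.
  have sp := simple_path_cat uPC uQ PA QT CA Q0.
  rewrite wb' // H //.
    rewrite !inE !size_cat !addnA /= addn1.
    have [k0 k'0] : (0 < k /\ 0 < k')%N by lia.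
    by case: sz => ->; rewrite prednK // eqxx ?orbT.
  apply: cut_weight_block => //.
    by move=> z /PA; rewrite inner_partP => /andP[].
  move=> z; rewrite mem_cat inE => /orP[/CA|/eqP-> //].
  by rewrite inner_partP => /andP[].
move=> nu [AT AA TA Ad Td]; exists nu => p sp; rewrite -wb' //.
(* With this second potential, [b' i j] is [u i - u j] plus [nu] on each arc of the cut; along a
   path the potential telescopes to [- nu]. *)
pose u i := if (i \notin S) || (i == ord_max) then nu else 0.
have u0 : u ord0 = 0 by rewrite /u S0 -val_eqE /= eq_sym -[_ == _]negbK -lt0n n0.
have un : u ord_max = nu by rewrite /u eqxx orbT.
case/and3P: (sp) => pp /eqP l _.
pose w i j : R := u i - u j + nu * ((i \in S) && (j \notin S))%:R.
transitivity (weight w ord0 p); last first.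
  by rewrite weight_potential l u0 un /cut_weight; ring.
apply: eq_weight_path pp => i j; rewrite /w.
have uI z : inner z -> u z = if z \in S then 0 else nu.
  by rewrite innerE /u => /andP[_ /negPf->]; rewrite orbF; case: (z \in S).
case/or3P.
- case/andP=> /eqP-> ij; rewrite u0 S0 uI //=.
  have -> : b' ord0 j = 0 by rewrite /b' g0 /g ij mul1r sub0r addNr.
  by case: (j \in S) => /=; ring.
- case/andP=> ii /eqP->; rewrite un uI // Sn andbF mulr0 addr0.
  case: (boolP (i \in S)) => iS; first by rewrite Ad ?sub0r // inner_partP iS.
  by rewrite Td ?inE // subrr.
- case/and3P=> ii ij ne; rewrite !uI //.
  case: (boolP (i \in S)) => iS; case: (boolP (j \in S)) => jS /=.
  + by rewrite AA ?inner_partP ?iS ?jS ?ii ?ij ?orbT //; ring.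
  + by rewrite AT ?inner_partP ?inE ?iS ?jS ?ii //; ring.
  + by rewrite TA ?inner_partP ?inE ?iS ?jS ?ii ?ij ?orbT //; ring.
  + by rewrite AT ?inner_partP ?inE ?iS ?jS ?ii ?ij ?orbT //; ring.
Qed.

(** The path visits [(size p).+1] distinct nodes, too many to fit into [S]. *)
Lemma cut_weight_simple_ge1 p : simple_path p -> (#|S| <= size p)%N ->
  1 <= cut_weight R S ord0 p.
Proof.
case/and3P=> _ _ up Sp.
have /subsetPn[y yp yS] : ~~ (mem (ord0 :: p) \subset S).
  apply/negP => /subset_leq_card; rewrite (card_uniqP up) /=.
  by move: Sp; rewrite leqNgt => /negP.
apply: (@cut_weight_ge1 _ _ _ _ _ y) => //; move: yp; rewrite inE => /predU1P[y0|//].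
by rewrite y0 S0 in yS.
Qed.

(** The [k.-1] inner nodes of the path can all be chosen in S'. Such a path violates the min-cut
    inequality. *)
Lemma exists_path_inside k : (2 <= k < #|S|)%N ->
  exists p, [/\ simple_path p, size p = k & cut_weight R S ord0 p = 0].
Proof.
case/andP=> k2 kS.
have Sn1 : (#|S| <= n.+1)%N by have := max_card (mem S); rewrite card_ord.
have cA := card_inner_part ltac:(lia).
have kA : (k.-1 <= #|inner_part|)%N by lia.
have [q [uq qA sq]] := @exists_completion _ inner_part [::] k.-1 isT
  ltac:(by []) kA.
exists (q ++ [:: ord_max]); split.
- apply: simple_path_inner => //; last by rewrite -size_eq0 sq; lia.
  by apply/allP => z /qA; rewrite inner_partP => /andP[].
- by rewrite size_cat sq /=; lia.
- apply: cut_weight_head => z; rewrite mem_cat inE => /orP[/qA|/eqP-> //].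
  by rewrite inner_partP => /andP[].
Qed.

(** A path starting 0, j, a, l with [a] in S' and [j], [l] outside [S] crosses the cut at least
    twice. *)
Lemma exists_path_crossing k : (2 < #|S| < k)%N -> (k <= n)%N ->
  exists p, [/\ simple_path p, size p = k & cut_weight R S ord0 p != 1].
Proof.
case/andP=> S3 Sk kn; have n0 : (0 < n)%N by lia.
have cA := card_inner_part n0.
have cS : (#|S| + #|~: S| = n.+1)%N by rewrite cardsC card_ord.
have A0 : (0 < #|inner_part|)%N by lia.
have [a aA] : exists a, a \in inner_part by apply/card_gt0P.
have T2 : (2 <= #|~: S|)%N by lia.
have [jl [ujl jlT]] := @exists_completion _ (~: S) [::] 2 isT ltac:(by []) T2.
case: jl ujl jlT => [|j [|l [|]]] // ujl jlT _.
have jS : j \notin S by have := jlT j; rewrite !inE eqxx => /(_ isT).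
have lS : l \notin S by have := jlT l; rewrite !inE eqxx orbT => /(_ isT).
have [aS ia] : a \in S /\ inner a by apply/andP; rewrite -inner_partP.
pose I := [set i : node n | inner i].
have cI : #|I| = n.-1.
  have -> : I = ~: [set ord0; ord_max].
    by apply/setP => i; rewrite !inE innerE negb_or.
  have := cardsC [set ord0; ord_max : node n]; rewrite card_ord cards2.
  by rewrite -val_eqE /= eq_sym -lt0n n0; lia.
have jI : inner j by apply: notin_inner.
have lI : inner l by apply: notin_inner.
(* The nodes [j], [a], [l] and the sink account for four of the [k] arcs. *)
have [|z||q [uq qI sq]] := @exists_completion _ I [:: j; a; l] (k - 4).
- move: ujl; rewrite /= !inE !negb_or !andbT => ->.
  by rewrite andbT; apply/andP; split; [apply: contraNneq jS => ->|apply: contraNneq lS => <-].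
- by rewrite !inE => /or3P[] /eqP->.
- by rewrite /= cI; lia.
exists (([:: j; a; l] ++ q) ++ [:: ord_max]); split.
- apply: simple_path_inner => //.
  apply/allP => z; rewrite mem_cat !inE => /orP[/or3P[] /eqP-> //|/qI].
  by rewrite inE.
- by rewrite !size_cat sq /=; lia.
- rewrite /cut_weight /= S0 jS aS lS /= -/(cut_weight R S l (q ++ [:: ord_max])).
  have := cut_weight_ge0 R S l (q ++ [:: ord_max]).
  by move=> h; apply/eqP => e; move: e h; rewrite andbF mulr0n; lra.
Qed.

End Cut.

(** * The facet property from two cardinalities, and both equivalences *)

Lemma facet_of_card (R : realType) (n : nat) (c : seq nat) (S : {set node n})
    (k k' : nat) :
    ord0 \in S -> ord_max \in S -> (2 < #|S| <= k)%N -> (k < k' <= n)%N ->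
    k \in c -> k' \in c -> all (leq k) c ->
  facet_defining_ge (path_polytope n R c) (arc_sum (cut S (~: S)%SET)) 1.
Proof.
move=> S0 Sn hS hk kc k'c /allP cmin; have n0 : (0 < n)%N by lia.
have [q [sq szq cq]] := @exists_path_crossing n R S S0 Sn k'
  ltac:(lia) ltac:(lia).
apply: (@facet_criterion R _ _ (incidences n R c) _
  (arc_sum (cut [set ord0]%SET [set: node n]%SET)) _ _ (incidence R q)).
- exact: incidencesP.
- by move=> _ [p [sp _ ->]]; apply: arc_sum_source.
- move=> _ [p [sp szp ->]]; rewrite /= arc_sum_cut //.
  apply: cut_weight_simple_ge1 => //; apply: leq_trans (cmin _ szp).
  by case/andP: hS.
- by apply/incidencesP; exists q; rewrite szq.
- by rewrite /= arc_sum_cut.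
(* A generator outside the span of the tight ones and [q] would be separated by weights that vanish
   on that span. *)
move=> x xL; apply: contraT => xU.
have [b [bU bx]] := exists_separating_weights xU.
(* Pairs that are not arcs get the default weight 0; no path uses them. *)
pose B i j : R := if insub (i, j) is Some a then b a else 0.
have BE p : simple_path p ->
    \sum_a b a * incidence R p a = weight B ord0 p.
  move=> sp; rewrite -sum_incidence //; apply: eq_bigr => a _.
  by rewrite /B -surjective_pairing valK.
have [|nu Bnu] := @weight_of_tight n R S S0 Sn B k k' hS hk.
  move=> p sp szp cp; rewrite -BE // bU //; apply/(subvP (addvSl _ _))/memv_span.
  rewrite mem_filter /= arc_sum_cut // cp eqxx; apply/incidencesP; exists p; split=> //.
  by move: szp; rewrite !inE => /orP[] /eqP ->.
(* The weights vanish on [q], which is not tight, so the scalar is 0 and the weights vanish on every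
   path, including [x]. *)
have nu0 : nu = 0.
  have := Bnu q sq; rewrite -BE // bU; last first.
    by apply/(subvP (addvSr _ _))/memv_line.
  by move/esym/eqP; rewrite mulf_eq0 subr_eq0 (negPf cq) orbF => /eqP.
move/incidencesP: xL bx => [p [sp _ ->]]; rewrite BE // Bnu // nu0 mul0r eqxx.
by [].
Qed.

Theorem theorem11 (R : realType) (n : nat) (c : seq nat) (S : {set node n})
    (hn : (4 <= n)%N)
    (hm : (2 <= size c)%N)
    (hc1 : (2 <= head 0 c)%N)
    (hinc : sorted ltn c)
    (hcm : (last 0 c <= n)%N)
    (hc23 : c <> [:: 2; 3]%N)
    (hS0 : ord0 \in S)
    (hSn : ord_max \in S) :
  (valid_ge (path_polytope n R c) (arc_sum (cut S (~: S)%SET)) 1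
     <-> (#|S| <= head 0 c)%N) /\
  (facet_defining_ge (path_polytope n R c) (arc_sum (cut S (~: S)%SET)) 1
     <-> (3 <= #|S| <= head 0 c)%N /\ (2 <= #|~: S|)%N).
Proof.
case: c hm hc1 hinc hcm hc23 => [|k [|k' c']] // _; rewrite [head _ _]/=.
set c := k :: k' :: c' => k2 hinc hcm _.
have kmin : all (leq k) c.
  rewrite /= leqnn /=; have := order_path_min ltn_trans hinc.
  by apply: sub_all => i /ltnW.
have kk' : (k < k')%N by case/andP: hinc.
have k'n : (k' <= n)%N.
  apply: leq_trans hcm; rewrite /c /=; have := mem_last k' c'.
  rewrite inE => /predU1P[->//|h].
  by case/andP: hinc => _ /(order_path_min ltn_trans)/allP/(_ _ h)/ltnW.
have n0 : (0 < n)%N by lia.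
have hv : valid_ge (path_polytope n R c) (arc_sum (cut S (~: S)%SET)) 1
     <-> (#|S| <= k)%N.
  split=> [V|Sk]; last first.
    apply: conv_hull_valid => _ [p [sp szp ->]]; rewrite /= arc_sum_cut //.
    by apply: cut_weight_simple_ge1 => //; apply: leq_trans (allP kmin _ szp).
  rewrite leqNgt; apply/negP => kS.
  (* If |S| > c_1, some path with c_1 arcs stays inside [S] and has cut value 0. *)
  have [p [sp szp cp]] := @exists_path_inside n R S hS0 hSn k ltac:(lia).
  have /V : path_polytope n R c (incidence R p).
    by apply: conv_hull_sub; exists p; rewrite szp mem_head.
  by rewrite arc_sum_cut // cp; lra.
split=> //; split; last first.
  case=> hS _.
  apply: (@facet_of_card R n c S k k') => //; first by lia.
  - by rewrite mem_head.
  - by rewrite !inE eqxx orbT.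
case=> /hv Sk [d [dP dF]].
have cS : (#|S| + #|~: S| = n.+1)%N by rewrite cardsC card_ord.
(* |S| <= c_1 < c_2 <= n leaves at least two of the n+1 nodes outside [S]. *)
split; last by lia.
rewrite Sk andbT leqNgt; apply/negP => S3.
(* When [S] consists of the terminals only, the cut is the set of arcs leaving 0. The inequality is
   then an equation on the polytope, and the face would have dimension both d and d - 1. *)
have cutE : cut S (~: S) = cut [set ord0] [set: node n].
  have cA := card_inner_part hS0 hSn n0.
  have A0 : inner_part S = finset.set0 by apply/eqP; rewrite -cards_eq0; lia.
  have Sin i : inner i -> i \in S = false.
    by move=> ii; have := inner_partP S i; rewrite A0 inE ii andbT.
  apply/finset.setP => -[[i j] /= aij]; rewrite !inE /= andbT.
  have [i0|i0] := eqVneq i ord0.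
    by move: aij; rewrite i0 hS0 adj_ord0 => /Sin ->.
  have /Sin -> // : inner i.
  by move: aij; rewrite /adj (negPf i0) /= => /orP[/andP[]|/and3P[]].
have PF : (fun x => path_polytope n R c x /\ arc_sum (cut S (~: S)) x = 1)
          = path_polytope n R c.
  apply/seteqP; split=> x; first by case.
  move=> Px; split=> //; rewrite cutE.
  by apply: conv_hull_scalar Px => _ [p [sp _ ->]]; apply: arc_sum_source.
by rewrite PF in dF; have := has_dim_unique dP dF; lia.
Qed.
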